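(* Let $k\geq 2$ be an integer. Let $D=H[S_1,\ldots,S_h]$ be a semicomplete composition such that $|V(D)\setminus V(S_i)|\geq 2k-3$ for each $i\in[h]$. If $D$ is $3k$-strong and $\delta^+(D)\geq 23k$, then $D$ is $k$-linked.
   Context: All digraphs are finite and simple (no loops, no parallel arcs; opposite arcs allowed). Paths are directed paths with distinct vertices; ''disjoint'' means vertex-disjoint. Composition: let $H$ be a digraph on $h\geq 2$ vertices $v_1,\dots,v_h$ and $S_1,\dots,S_h$ pairwise vertex-disjoint digraphs; $D=H[S_1,\dots,S_h]$ has vertex set $V(S_1)\cup\dots\cup V(S_h)$ and arc set $\bigcup_i A(S_i)\cup\{s_is_j : s_i\in V(S_i), s_j\in V(S_j), v_iv_j\in A(H)\}$. It is a semicomplete composition if $H$ is semicomplete (at least one arc between any two distinct vertices). A digraph is $k$-strong if it has at least $k+1$ vertices and deleting any set of at most $k-1$ vertices leaves a digraph with a directed path from $x$ to $y$ for every ordered pair of distinct vertices. A digraph $D$ is $k$-linked if $|V(D)|\geq 2k$ and for any $2k$ distinct vertices $x_1,\dots,x_k,y_1,\dots,y_k$ there are disjoint paths $P_1,\dots,P_k$ with $P_i$ from $x_i$ to $y_i$. $\delta^+(D)$ is the minimum out-degree. *)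

(* Defs.v *)
From HB Require Import structures.
From mathcomp Require Import all_boot.

Set Implicit Arguments.
Unset Strict Implicit.
Unset Printing Implicit Defensive.

Record digraph := Digraph {
  vertex :> finType;
  darc : rel vertex;
  darc_irr : irreflexive darc
}.

Definition outdeg (D : digraph) (x : D) : nat := #|[set y | darc x y]|.

(* Every out-degree is < #|D|, so the default #|D| of the iterated minimum
   is never attained when D has a vertex. *)
Definition min_outdeg (D : digraph) : nat :=
  \big[minn/#|D|]_(x : D) outdeg x.

(* The path has vertex sequence x :: p. *)
Definition dipath (D : digraph) (x y : D) (p : seq D) : bool :=
  [&& path (@darc D) x p, last x p == y & uniq (x :: p)].

Definition strong (D : digraph) : Prop :=
  forall x y : D, x != y -> exists p : seq D, dipath x y p.

Section Delete.
Variables (D : digraph) (X : {set D}).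

Definition del_vertex : finType := {x : D | x \notin X}.
Definition del_arc : rel del_vertex := fun x y => darc (val x) (val y).

Lemma del_arc_irr : irreflexive del_arc.
Proof. by move=> x; exact: darc_irr. Qed.

Definition del : digraph := Digraph del_arc_irr.
End Delete.

Definition kstrong (k : nat) (D : digraph) : Prop :=
  k + 1 <= #|D| /\ forall X : {set D}, #|X| < k -> strong (del X).

Definition klinked (k : nat) (D : digraph) : Prop :=
  2 * k <= #|D| /\
  forall x y : 'I_k -> D,
    injective x -> injective y -> (forall i j, x i != y j) ->
    exists P : 'I_k -> seq D,
      (forall i, dipath (x i) (y i) (P i)) /\
      (forall i j, i != j -> [disjoint x i :: P i & x j :: P j]).

Definition semicomplete (H : digraph) : Prop :=
  forall u v : H, u != v -> darc u v || darc v u.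

(* The composition H[S_v : v in V(H)]; the disjoint union of the V(S v) is the
   type of pairs (v, s) with s : S v.  When tag a = tag b, tagged_as a b is
   tagged b seen as a vertex of S (tag a). *)
Section Composition.
Variables (H : digraph) (S : H -> digraph).

Definition comp_vertex : finType := {v : H & S v}.
Definition comp_arc : rel comp_vertex := fun a b =>
  ((tag a == tag b) && darc (tagged a) (tagged_as a b)) || darc (tag a) (tag b).

Lemma comp_arc_irr : irreflexive comp_arc.
Proof. by case=> v s; rewrite /comp_arc tagged_asE !darc_irr andbF. Qed.

Definition composition : digraph := Digraph comp_arc_irr.

Definition part (v : H) : {set composition} :=
  [set a : composition | tag (a : comp_vertex) == v].
End Composition.

(* Main.v *)
Require Import Defs.
From mathcomp Require Import all_boot zify.
From Stdlib Require Import Classical.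

Set Implicit Arguments.
Unset Strict Implicit.
Unset Printing Implicit Defensive.

(* If some part K has fewer than 3k vertices outside it, the hypotheses force all
   arcs in both directions between K and its complement, and the pairs are linked
   by hand.  Otherwise completing the parts, except for the arcs that enter the
   terminals y_i from their own part, gives a 3k-strong semicomplete digraph in
   which every linkage shortens to one that only uses arcs of D.

   In a semicomplete digraph let X and Y be the sets of sources and sinks, B a set
   of 3k vertices of highest in-degree, and U the set of vertices with more than k
   in-neighbours in B.  A source with at least k out-neighbours outside U is given
   one of them, z_i; the digraph minus X and all the z_i is still k-strong and
   Menger's theorem yields k disjoint paths from B to Y of minimal total length.
   By minimality a vertex of B that starts no path sends arcs only to the first two
   vertices of each path, and its out-neighbours only to the first three.  Since
   z_i dominates all but k vertices of B, both kinds of sources reach, through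
   vertices off the paths, large sets of such out-neighbours; from these the start
   s of the relevant path is at distance at most two in many ways, because s has
   in-degree at least that of the vertices of these sets. *)

(** * Minima, greedy choice and cardinalities in finite types *)

Lemma ex_minimum (A : Type) (P : A -> Prop) (m : A -> nat) :
  (exists a, P a) -> exists2 a, P a & forall b, P b -> m a <= m b.
Proof.
case=> a; have [n le_mn] := ubnP (m a); elim: n => // n IHn in a le_mn * => Pa.
have [[b [Pb lt_ba]]|no] := classic (exists b, P b /\ m b < m a).
  by apply: (IHn b); [apply: leq_trans lt_ba _|].
by exists a => // b Pb; rewrite leqNgt; apply/negP => lt_ba; apply: no; exists b.
Qed.

Lemma card_leD (T : finType) (A B : {set T}) : #|A| <= #|A :\: B| + #|B|.
Proof. by rewrite -(cardsID B A) addnC leq_add2l subset_leq_card // subsetIr. Qed.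

(** Values are chosen one index at a time, [F] being the fewer than [k] values already taken. As
    [R i] may be an implication, indices that need no special vertex can take part, and [f] stays
    injective on all of ['I_k]. *)
Lemma greedy_sdr (T : finType) k (R : 'I_k -> T -> Prop) :
    (forall i (F : {set T}), #|F| < k -> exists2 t, t \notin F & R i t) ->
  exists2 f : 'I_k -> T, injective f & forall i, R i (f i).
Proof.
move=> hR.
have step n : n <= k -> exists f : 'I_k -> T,
    (forall i : 'I_k, i < n -> R i (f i)) /\
    (forall i j : 'I_k, i < n -> j < n -> f i = f j -> i = j).
  elim: n => [_|n IHn lt_nk].
    (* No value is prescribed yet, but [T] may be empty: for [k = 0] the domain is empty, otherwise
       [hR] supplies a vertex. *)
    case: k R hR => [|k] R hR; first by exists (fun i : 'I_0 => match i with Ordinal _ h =>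
      match notF h with end end); split=> [] [].
    have [|t _ _] := hR ord0 set0; first by rewrite cards0.
    by exists (fun=> t).
  have [f [fR finj]] := IHn (ltnW lt_nk).
  pose F := [set f i | i in [set i : 'I_k | i < n]].
  have cF : #|F| < k.
    apply: leq_ltn_trans (leq_imset_card _ _) (leq_ltn_trans _ lt_nk).
    rewrite cardE -(size_map val) -[leqRHS](size_iota 0) uniq_leq_size //.
      by rewrite map_inj_uniq ?enum_uniq //; apply: val_inj.
    by move=> m /mapP[i]; rewrite mem_enum inE mem_iota /= => ? ->.
  have [t tF Rt] := hR (Ordinal lt_nk) F cF.
  exists (fun i : 'I_k => if i == n :> nat then t else f i); split=> [i|i j].
    rewrite ltnS leq_eqVlt; case: eqP => [e _|_] /=; last exact: fR.
    by rewrite (_ : i = Ordinal lt_nk) //; apply: val_inj.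
  rewrite !ltnS (leq_eqVlt i) (leq_eqVlt j); case: (eqVneq (i : nat) n) => [ei _|_ /= li];
    case: (eqVneq (j : nat) n) => [ej _|_ /= lj].
  - by move=> _; apply: val_inj; rewrite /= ei ej.
  - by move=> e; case/negP: tF; rewrite e; apply/imsetP; exists j; rewrite ?inE.
  - by move=> e; case/negP: tF; rewrite -e; apply/imsetP; exists i; rewrite ?inE.
  - exact: finj.
have [f [fR finj]] := step k (leqnn k).
by exists f => [i j|i]; [apply: finj|apply: fR].
Qed.

Lemma top_subset (T : finType) (g : T -> nat) (A : {set T}) m : m <= #|A| ->
  exists B : {set T}, [/\ B \subset A, #|B| = m &
    forall b w, b \in B -> w \in A :\: B -> g w <= g b].
Proof.
elim: m => [_|m IHm lt_m].
  by exists set0; split=> [||b w]; rewrite ?sub0set ?cards0 ?in_set0.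
have [B [sBA cB topB]] := IHm (ltnW lt_m).
have [a aAB] : exists a, a \in A :\: B.
  by apply/set0Pn; rewrite -card_gt0; have := card_leD A B; lia.
case: (@arg_maxnP _ a (mem (A :\: B)) g aAB) => c /=; rewrite in_setD => cAB maxc.
have cB' : c \notin B by case/andP: cAB.
exists (c |: B); split.
- by rewrite subUset sub1set sBA andbT; case/andP: cAB.
- by rewrite cardsU1 cB' cB.
move=> b w; rewrite !inE negb_or => /orP[/eqP->|bB] /andP[/andP[_ wB] wA].
  by apply: maxc; rewrite !inE wB.
by apply: topB; rewrite // !inE wB.
Qed.

Lemma card_imset_ord (T : finType) k (f : 'I_k -> T) : #|[set f i | i in 'I_k]| <= k.
Proof. by apply: leq_trans (leq_imset_card _ _) _; rewrite card_ord. Qed.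

Lemma cardU_le (T : finType) (A B : {set T}) : #|A :|: B| <= #|A| + #|B|.
Proof. by rewrite leq_card_setU. Qed.

Lemma subset_card_notin (T : finType) (A F : {set T}) :
  #|F| < #|A| -> exists2 t, t \notin F & t \in A.
Proof.
move=> lt; have /set0Pn[t] : A :\: F != set0.
  by rewrite -card_gt0; have := card_leD A F; lia.
by rewrite in_setD => /andP[]; exists t.
Qed.

Lemma disjointP (T : finType) (l1 l2 : seq T) :
  (forall v, v \in l1 -> v \in l2 -> False) -> [disjoint l1 & l2].
Proof.
by move=> h; apply/pred0P => v /=; apply/negP => /andP[? ?]; apply: (h v).
Qed.

Lemma disjointF (T : finType) (l1 l2 : seq T) v :
  [disjoint l1 & l2] -> v \in l1 -> v \in l2 -> False.
Proof. by move=> /pred0P/(_ v) /= h v1 v2; rewrite v1 v2 in h. Qed.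

(** * Linkages and Menger's theorem *)

(** A path may repeat its own vertices, so that concatenations need no check; [linkage_uniq] removes
    the repetitions afterwards. *)
Definition linkage (T : finType) (E : rel T) k (x y : 'I_k -> T)
    (P : 'I_k -> seq T) : Prop :=
  (forall i, path E (x i) (P i) /\ last (x i) (P i) = y i) /\
  (forall i j, i != j -> [disjoint x i :: P i & x j :: P j]).

Definition connected_avoiding (T : finType) (E : rel T) (C : {set T}) : Prop :=
  forall a b, a \notin C -> b \notin C ->
    exists p, [/\ path E a p, last a p = b & all [predC C] (a :: p)].

Lemma linkage_uniq (T : finType) (E : rel T) k (x y : 'I_k -> T) P :
  linkage E x y P -> exists2 Q, linkage E x y Q & forall i, uniq (x i :: Q i).
Proof.
case=> hp dp; exists (fun i => shorten (x i) (P i)); last first.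
  by move=> i; have [pp _] := hp i; case/shortenP: pp.
split=> [i|i j /dp d].
  by have [pp <-] := hp i; case/shortenP: pp.
have sub l : {subset x l :: shorten (x l) (P l) <= x l :: P l}.
  have [pp _] := hp l; case/shortenP: pp => p' _ _ sp' v.
  by rewrite !in_cons => /orP[->//|/sp'->]; rewrite orbT.
by apply: disjointP => v /sub vi /sub vj; apply: disjointF d vi vj.
Qed.

Definition separator (T : finType) (E : rel T) (A B C : {set T}) : Prop :=
  forall a p, a \in A -> path E a p -> last a p \in B -> has (mem C) (a :: p).

Definition disjoint_paths (T : finType) (E : rel T) (A B : {set T}) k
    (s : 'I_k -> T) (p : 'I_k -> seq T) : Prop :=
  (forall i, [/\ s i \in A, path E (s i) (p i) & last (s i) (p i) \in B]) /\
  (forall i j, i != j -> [disjoint s i :: p i & s j :: p j]).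

Lemma disjoint_paths_uniq (T : finType) (E : rel T) (A B : {set T}) k
    (s : 'I_k -> T) (p : 'I_k -> seq T) : disjoint_paths E A B s p ->
  exists q, disjoint_paths E A B s q /\ forall i, uniq (s i :: q i).
Proof.
case=> hp dp; have [|q [hq dq] uq] :=
  @linkage_uniq T E k s (fun i => last (s i) (p i)) p.
  by split=> // i; have [] := hp i.
exists q; split=> //; split=> // i.
by have [? _ ?] := hp i; have [? ->] := hq i.
Qed.

Lemma disjoint_inj (T : finType) k (l : 'I_k -> seq T) (f : 'I_k -> T) :
  (forall i j, i != j -> [disjoint l i & l j]) -> (forall i, f i \in l i) ->
  injective f.
Proof.
move=> dl fl i j e; apply: contraTeq isT => /dl /pred0P/(_ (f i)) /=.
by rewrite fl e fl.
Qed.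

Lemma inj_onto_set (T : finType) k (S : {set T}) (f : 'I_k -> T) : injective f ->
  (forall i, f i \in S) -> #|S| <= k -> forall v, v \in S -> exists i, f i = v.
Proof.
move=> finj fS cS v vS; suff /imsetP[i _ ->] : v \in f @: setT by exists i.
have /eqP -> // : f @: setT == S.
rewrite eqEcard card_imset // cardsT card_ord cS andbT.
by apply/subsetP => _ /imsetP[i _ ->].
Qed.

(* Goering's induction on the number of arcs: if deleting the arc x -> y creates
   a separator S with fewer than k vertices, then x |: S and y |: S are
   separators with k vertices, and the paths leading to the first and from the
   second are glued along S and x -> y. *)
Theorem menger (T : finType) k (E : rel T) (A B : {set T}) :
    (forall C : {set T}, separator E A B C -> k <= #|C|) ->
  exists s p, @disjoint_paths T E A B k s p.
Proof.
have [n] := ubnP #|[set e : T * T | E e.1 e.2]|.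
elim: n => // n IHn in E A B *; rewrite ltnS => cE hsep.
have [e0|[[x y]]] := set_0Vmem [set e : T * T | E e.1 e.2].
  have noE u v : E u v = false.
    by have := in_set0 (u, v); rewrite -e0 inE.
  have cAB : k <= #|A :&: B|.
    apply: hsep => a [|b p] aA //=; last by rewrite noE.
    by move=> _ aB; rewrite inE aA aB.
  have [f finj fAB] : exists2 f : 'I_k -> T, injective f & forall i, f i \in A :&: B.
    apply: (@greedy_sdr _ _ (fun _ t => t \in A :&: B)) => i F cF.
    have /set0Pn[t] : (A :&: B) :\: F != set0.
      by rewrite -card_gt0; have := card_leD (A :&: B) F; lia.
    by rewrite in_setD => /andP[]; exists t.
  exists f, (fun=> [::]); split=> [i|i j ij].
    by have := fAB i; rewrite inE => /andP[].
  apply: disjointP => v; rewrite !inE => /eqP-> /eqP /finj ee.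
  by rewrite ee eqxx in ij.
rewrite inE /= => Exy.
pose E' u v := E u v && ((u, v) != (x, y)).
have cE' : #|[set e : T * T | E' e.1 e.2]| < n.
  apply: leq_trans cE; apply: proper_card; apply/properP; split.
    by apply/subsetP => -[u v]; rewrite !inE => /andP[].
  by exists (x, y); rewrite !inE //= /E' eqxx andbF.
have subE : subrel E' E by move=> u v /andP[].
have [big|small] := classic (forall C : {set T}, separator E' A B C -> k <= #|C|).
  have [s [p [hp dp]]] := IHn E' A B cE' big; exists s, p; split=> // i.
  by have [? pp ?] := hp i; split=> //; apply: sub_path pp.
have {small}[S [sepS cS]] : exists S : {set T}, separator E' A B S /\ #|S| < k.
  apply: NNPP => no; apply: small => C sepC; rewrite leqNgt; apply/negP => lt.
  by apply: no; exists C.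
have E'x a p : x \notin belast a p -> path E a p -> path E' a p.
  elim: p a => //= b p IHp a; rewrite inE negb_or => /andP[xa xp] /andP[ab pp].
  by rewrite /E' ab IHp // andbT; apply: contraNneq xa => -[->].
have E'y a p : y \notin p -> path E a p -> path E' a p.
  elim: p a => //= b p IHp a; rewrite inE negb_or => /andP[yb yp] /andP[ab pp].
  by rewrite /E' ab IHp // andbT; apply: contraNneq yb => -[_ ->].
have sepx : separator E A B (x |: S).
  move=> a p aA pp lp; have [xp|xp] := boolP (x \in a :: p).
    by apply/hasP; exists x => //; rewrite inE; apply: setU11.
  have /hasP[v vp vS] : has (mem S) (a :: p).
    apply: sepS lp => //; apply: E'x pp; apply: contra xp; exact: mem_belast.
  by apply/hasP; exists v => //; apply: setU1r.
have sepy : separator E A B (y |: S).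
  move=> a p aA pp lp; have [yp|yp] := boolP (y \in a :: p).
    by apply/hasP; exists y => //; rewrite inE; apply: setU11.
  have /hasP[v vp vS] : has (mem S) (a :: p).
    apply: sepS lp => //; apply: E'y pp; apply: contra yp => ?; exact: mem_behead.
  by apply/hasP; exists v => //; apply: setU1r.
have cx := hsep _ sepx; have cy := hsep _ sepy.
have xS : x \notin S by apply/negP => h; move: cx; rewrite cardsU1 h; lia.
have yS : y \notin S by apply/negP => h; move: cy; rewrite cardsU1 h; lia.
have cx' : #|x |: S| <= k by rewrite cardsU1 xS; lia.
have cy' : #|y |: S| <= k by rewrite cardsU1 yS; lia.
(* An [E']-separator of [A] from [x |: S] also separates [A] from [B] in [E]: an [A]-[B] path, cut
   at its first vertex in [x |: S], does not leave [x] and so avoids the deleted arc. The next step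
   is symmetric, with the last vertex in [y |: S]. *)
have [s [p0 lk0]] : exists s p, @disjoint_paths T E' A (x |: S) k s p.
  apply: IHn => // C sepC; apply: hsep => a p aA pp lp.
  have hx := sepx a p aA pp lp.
  have [p1 [p2 [ep lp1 nb]]] : exists p1 p2, [/\ p = p1 ++ p2,
      last a p1 \in x |: S & x \notin belast a p1].
    move: hx; elim: (p) a {aA pp lp} => [|b q IHq] a /=.
      by rewrite orbF => h; exists [::], [::].
    have [aS _|aS /= /IHq[p1 [p2 [-> ? ?]]]] := boolP (a \in x |: S).
      by exists [::], (b :: q).
    exists (b :: p1), p2; split=> //=; rewrite inE negb_or; apply/andP; split=> //.
    by apply: contraNneq aS => <-; apply: setU11.
  move: pp; rewrite ep cat_path => /andP[pp1 _].
  have /hasP[v vp vC] := sepC a p1 aA (E'x _ _ nb pp1) lp1.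
  by apply/hasP; exists v => //; rewrite -cat_cons mem_cat vp.
have [s' [p0' lk0']] : exists s p, @disjoint_paths T E' (y |: S) B k s p.
  apply: IHn => // C sepC; apply: hsep => a p aA pp lp.
  have hy := sepy a p aA pp lp.
  have [b [q [sub bS pq lq yq]]] : exists b q, [/\ {subset b :: q <= a :: p},
      b \in y |: S, path E b q, last b q = last a p & y \notin q].
    move: hy pp; elim: (p) a {aA lp} => [|b q IHq] a /=.
      by rewrite orbF => h _; exists a, [::]; split=> // v.
    move=> + /andP[ab pq]; have [hq _|hq] := boolP (has (mem (y |: S)) (b :: q)).
      have [b' [q' [sub ? ? ? ?]]] := IHq b hq pq; exists b', q'; split=> //.
      by move=> v /sub; rewrite !inE => ->; rewrite orbT.
    rewrite /= in hq; rewrite (negPf hq) orbF => aS; exists a, (b :: q); split=> //=.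
      by rewrite ab.
    apply: contra hq => yq.
    by apply/(@hasP _ (mem (y |: S)) (b :: q)); exists y => //=; apply: setU11.
  rewrite -lq in lp; have /hasP[v vp vC] := sepC b q bS (E'y _ _ yq pq) lp.
  by apply/hasP; exists v => //; apply: sub.
have [p [[hp dp] up]] := disjoint_paths_uniq lk0.
have [p' [[hp' dp'] up']] := disjoint_paths_uniq lk0'.
pose t i := last (s i) (p i).
have tinj : injective t.
  by apply: disjoint_inj dp _ => i; apply: mem_last.
have sinj : injective s'.
  by apply: disjoint_inj dp' _ => i; apply: mem_head.
have tS i : t i \in x |: S by have [] := hp i.
have sS i : s' i \in y |: S by have [] := hp' i.
have endx v i : v \in s i :: p i -> v \in S -> v = t i.
  move=> vp vS; have [j ej] := inj_onto_set tinj tS cx' (setU1r x vS).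
  have [->|/dp d] := eqVneq i j; first by [].
  by case: (disjointF d vp); rewrite -ej; apply: mem_last.
have endy v i : v \in s' i :: p' i -> v \in S -> v = s' i.
  move=> vp vS; have [j ej] := inj_onto_set sinj sS cy' (setU1r y vS).
  have [->|/dp' d] := eqVneq i j; first by [].
  by case: (disjointF d vp); rewrite -ej; apply: mem_head.
(* The first path up to [v] and the second from [v] on form an [E']-path from [A] to [B], which
   meets [S]. Since the first path meets [S] only at its end, the second only at its start, and
   neither repeats a vertex, the vertex met is [v]. *)
have meet v i j : v \in s i :: p i -> v \in s' j :: p' j -> v \in S.
  move=> vi vj; have [sA pi _] := hp i; have [_ pj lj] := hp' j.
  have ex u : u \in s i :: p i -> u \in S -> u = last (s i) (p i) := @endx u i.
  have ey u : u \in s' j :: p' j -> u \in S -> u = s' j := @endy u j.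
  case/splitPl: vi pi ex (up i) => p1 p2 l1; rewrite cat_path => /andP[pp1 _] ex ui.
  case/splitPl: vj pj lj ey (up' j) => q1 q2 l2.
  rewrite cat_path last_cat l2 => /andP[_ pq2] lq2 ey uj.
  have /hasP[u] : has (mem S) (s i :: p1 ++ q2).
    by apply: sepS; rewrite ?cat_path ?pp1 ?l1 ?last_cat ?l1.
  rewrite -cat_cons mem_cat => /orP[u1|u2] /= uS.
    have := ex u; rewrite -cat_cons mem_cat u1 last_cat l1 => /(_ isT uS) eu.
    suff -> : v = u by [].
    move: ui; rewrite eu -cat_cons cat_uniq => /and3P[_ /hasPn h _].
    case: (p2) h eu => // c p3 /(_ u) h eu.
    have uc : u \in c :: p3 by rewrite eu; exact: (mem_last c p3).
    by have := h uc; rewrite /= u1.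
  have eu : u = s' j by apply: ey; rewrite // -cat_cons mem_cat u2 orbT.
  by move: uj; rewrite /= mem_cat -eu u2 orbT.
(* A path ending in [S] is continued by the one starting there; the path ending in [x] is continued
   through the arc [x -> y]. *)
have [sg hsg] : exists sg : 'I_k -> 'I_k,
    forall i, s' (sg i) = if t i == x then y else t i.
  apply: (@fin_all_exists _ _ (fun i j => s' j = if t i == x then y else t i)) => i; apply: (inj_onto_set sinj sS cy').
  have := tS i; rewrite in_setU1; case: eqP => [_ _|_ /= h]; first exact: setU11.
  exact: setU1r.
exists s, (fun i => p i ++ (if t i == x then s' (sg i) :: p' (sg i) else p' (sg i))).
have cross i j v : v \in s i :: p i -> v \in s' (sg j) :: p' (sg j) -> i = j.
  move=> vi vj; have vS := meet _ _ _ vi vj.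
  have := endy _ _ vj vS; rewrite (endx _ _ vi vS) hsg => e.
  apply: tinj; rewrite e; case: eqP e => // _ e.
  by have := vS; rewrite (endx _ _ vi vS) e (negPf yS).
have sginj : injective sg.
  move=> i j e; have := hsg i; rewrite e hsg.
  have hy l : (t l == x) = false -> t l != y.
    move=> tx; apply: contraNneq yS => <-; have := tS l.
    by rewrite in_setU1 tx.
  case: ifP => [/eqP ti|/hy ti]; case: ifP => [/eqP tj|/hy tj] ee.
  - by apply: tinj; rewrite ti tj.
  - by rewrite ee eqxx in tj.
  - by rewrite ee eqxx in ti.
  - by apply: tinj.
split=> [i|i j ij].
  have [sA pi _] := hp i; have [_ pj lj] := hp' (sg i); split=> //.
    rewrite cat_path (sub_path subE pi) /= -/(t i); have := hsg i.
    case: eqP => [-> e|_ e] /=; last by rewrite -e (sub_path subE pj).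
    by rewrite e Exy -e (sub_path subE pj).
  by rewrite last_cat -/(t i); have := hsg i; case: eqP => [_ e|_ <-].
have split_mem l v : v \in s l :: p l ++
    (if t l == x then s' (sg l) :: p' (sg l) else p' (sg l)) ->
    v \in s l :: p l \/ v \in s' (sg l) :: p' (sg l).
  rewrite -cat_cons mem_cat => /orP[->|]; first by left.
  by case: ifP => _ h; right; rewrite // inE h orbT.
apply: disjointP => v /split_mem[vi|vi] /split_mem[vj|vj].
- exact: disjointF (dp _ _ ij) vi vj.
- by move: ij; rewrite (cross _ _ _ vi vj) eqxx.
- by move: ij; rewrite (cross _ _ _ vj vi) eqxx.
- by apply: disjointF (dp' _ _ _) vi vj; apply: contra_neq ij; apply: sginj.
Qed.

(** * Semicomplete digraphs *)

(** Averaging: inside [P] the in-degrees and the out-degrees have equal sums, and at each vertex the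
    two add up to at least [#|P| - 1]. *)
Lemma semicomplete_large_indeg (T : finType) (E : rel T) (P : {set T}) :
    (forall u v, u != v -> E u v || E v u) -> 0 < #|P| ->
  exists2 w, w \in P & #|P| <= 2 * #|[set u in P | E u w]| + 1.
Proof.
move=> semi P0; apply: NNPP => no.
have small w : w \in P -> 2 * #|[set u in P | E u w]| + 2 <= #|P|.
  by move=> wP; rewrite leqNgt; apply/negP => lt; apply: no; exists w => //; lia.
pose inn w := \sum_(u in P) (E u w : nat); pose out w := \sum_(u in P) (E w u : nat).
have innE w : #|[set u in P | E u w]| = inn w.
  rewrite -sum1dep_card /inn big_mkcondr /=; apply: eq_bigr => u _.
  by case: (E u w).
have deg w : w \in P -> #|P| - 1 <= inn w + out w.
  move=> wP; rewrite /inn /out -big_split /= -sum1_card (bigD1 w) //= addKn.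
  rewrite [leqRHS](bigD1 w) //=; apply: leq_trans (leq_addl _ _).
  apply: leq_sum => u /andP[_ /semi].
  by case: (E u w) => //= ->.
have sumE : \sum_(w in P) out w = \sum_(w in P) inn w by rewrite exchange_big.
have lo : \sum_(w in P) (#|P| - 1) <= \sum_(w in P) (inn w + out w).
  exact: leq_sum.
have hi : \sum_(w in P) (2 * inn w + 2) <= \sum_(w in P) #|P|.
  by apply: leq_sum => w wP; rewrite -innE small.
have dE : \sum_(w in P) 2 * inn w = 2 * \sum_(w in P) inn w by rewrite big_distrr.
rewrite big_split /= sumE sum_nat_const in lo.
rewrite big_split /= dE !sum_nat_const in hi; nia.
Qed.

(* Counting in-neighbours outside X: s has at least as many as w, so the
   in-neighbours of s missed by w, all of them heads of arcs from w, are at least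
   as many as the in-neighbours of w missed by s, which include those in P. *)
Lemma short_access (T : finType) (E : rel T) (X P : {set T}) (s : T) :
    irreflexive E -> (forall u v, u != v -> E u v || E v u) ->
    s \notin X -> s \notin P -> [disjoint X & P] -> 0 < #|P| ->
    (forall w, w \in P ->
       #|[set u | (u \notin X) && E u w]| <= #|[set u | (u \notin X) && E u s]|) ->
  exists2 w, w \in P &
    E w s \/ #|P| < 2 * #|[set u | [&& u \notin X, E w u & E u s]]|.
Proof.
move=> irr semi sX sP dXP P0 top.
have [w wP hw] := semicomplete_large_indeg semi P0.
have [[v [vP vs]]|no] := classic (exists v, v \in P /\ E v s).
  by exists v => //; left.
have noP v : v \in P -> E v s = false.
  by move=> vP; apply/negP => h; apply: no; exists v.
exists w => //; right; move: (top w wP).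
set Nw := [set u | _]; set Ns := [set u | (u \notin X) && E u s].
set M := [set u | _ & _] => cNN.
have Esw : E s w.
  have /semi : s != w by apply: contraNneq sP => ->.
  by rewrite (noP w) // orbF.
have sub1 : Ns :\: Nw \subset M.
  apply/subsetP => u; rewrite !inE negb_and negbK => /andP[h /andP[uX us]].
  rewrite uX us andbT /=; move: h; rewrite (negPf uX) /= => uw.
  have /semi : u != w by apply: contraTneq us => ->; rewrite noP.
  by rewrite (negPf uw).
(* Counting [s] besides the in-neighbours of [w] in [P] gains the one that makes the final
   inequality strict. *)
have sub2 : s |: [set u in P | E u w] \subset Nw :\: Ns.
  apply/subsetP => u; rewrite !inE negb_and negbK.
  case/orP => [/eqP->|/andP[uP uw]]; first by rewrite irr sX Esw orbT.
  have uX : u \notin X by rewrite (disjointFl dXP uP).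
  by rewrite uX uw (noP u uP) orbT.
have := subset_leq_card sub1; have := subset_leq_card sub2.
rewrite cardsU1 inE (negPf sP) /=.
have := cardsID Nw Ns; have := cardsID Ns Nw; rewrite (setIC Nw); lia.
Qed.

(** * Path systems of minimal total length *)

Definition path_system (T : finType) (E : rel T) (B : {set T}) k (y : 'I_k -> T)
    (s : 'I_k -> T) (p : 'I_k -> seq T) : Prop :=
  (forall j, [/\ s j \in B, path E (s j) (p j) & last (s j) (p j) = y j]) /\
  (forall i j, i != j -> [disjoint s i :: p i & s j :: p j]).

Definition minimal_system (T : finType) (E : rel T) (B : {set T}) k (y : 'I_k -> T)
    (s : 'I_k -> T) (p : 'I_k -> seq T) : Prop :=
  path_system E B y s p /\
  forall s' p', path_system E B y s' p' ->
    \sum_j size (p j) <= \sum_j size (p' j).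

(** Menger's paths reach the [k] sinks in an arbitrary order; reindexing by [f] makes path [i] end
    in [y i]. *)
Lemma ex_minimal_system (T : finType) (E : rel T) (B : {set T}) k (y : 'I_k -> T) :
    injective y ->
    (forall C, separator E B [set y i | i in 'I_k] C -> k <= #|C|) ->
  exists s p, minimal_system E B y s p.
Proof.
move=> yinj hsep; set Y := [set y i | i in 'I_k] in hsep.
have [s [p [hp dp]]] := menger hsep.
have linj : injective (fun j => last (s j) (p j)).
  by apply: disjoint_inj dp _ => i; apply: mem_last.
have [f hf] : exists f : 'I_k -> 'I_k, forall i, last (s (f i)) (p (f i)) = y i.
  apply: (@fin_all_exists _ _ (fun i j => last (s j) (p j) = y i)) => i.
  apply: (@inj_onto_set _ _ Y _ linj) => [j||]; last exact: imset_f.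
    by have [] := hp j.
  by rewrite card_imset // card_ord.
have finj : injective f by move=> i j e; apply: yinj; rewrite -!hf e.
have [[s' p'] sys min] : exists2 sp : ('I_k -> T) * ('I_k -> seq T),
    path_system E B y sp.1 sp.2 &
    forall sp', path_system E B y sp'.1 sp'.2 ->
      \sum_j size (sp.2 j) <= \sum_j size (sp'.2 j).
  apply: ex_minimum; exists (s \o f, p \o f); split=> [j|i j ij] /=.
    by have [? ? _] := hp (f j); rewrite hf.
  by apply: dp; apply: contra_neq ij; apply: finj.
by exists s', p'; split=> // s2 p2 h2; apply: (min (s2, p2)).
Qed.

Lemma minimal_system_replace (T : finType) (E : rel T) (B : {set T}) k
    (y : 'I_k -> T) s p j b q :
    minimal_system E B y s p -> b \in B -> path E b q -> last b q = y j ->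
    (forall i u, i != j -> u \in b :: q -> u \notin s i :: p i) ->
  size (p j) <= size q.
Proof.
case=> [[hp dp] min] bB pq lq dq.
pose s' i := if i == j then b else s i; pose p' i := if i == j then q else p i.
have dq' i : i != j -> [disjoint b :: q & s i :: p i].
  by move=> ij; apply: disjointP => u /(dq i u ij)/negP.
have : path_system E B y s' p'.
  split=> [i|i l il]; rewrite /s' /p'; first by case: eqP => [->|_].
  have [ei|ni] := eqVneq i j; have [el|nl] := eqVneq l j.
  - by rewrite ei el eqxx in il.
  - exact: dq'.
  - by rewrite disjoint_sym; apply: dq'.
  - exact: dp.
move=> /min; rewrite (bigD1 j) // [leqRHS](bigD1 j) //= /p' eqxx.
rewrite [in leqRHS](eq_bigr (fun i => size (p i))) ?leq_add2r //.
by move=> i /negPf ->.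
Qed.

(** The walk [r] followed by the rest of path [j] competes with path [j] and meets no other path. By
    minimality the initial segment it replaces, of length [a], is no longer than [r]. *)
Lemma minimal_system_detour (T : finType) (E : rel T) (B : {set T}) k
    (y : 'I_k -> T) s p j b r :
    minimal_system E B y s p -> b \in B -> path E b r ->
    last b r \in s j :: p j ->
    (forall i u, u \in belast b r -> u \notin s i :: p i) ->
  exists2 a, a <= size r & last b r = nth (s j) (s j :: p j) a.
Proof.
move=> msys bB pr; move: (msys) => [[hp dp] _]; have [_ pj lj] := hp j.
have le_size := minimal_system_replace msys bB.
have dj i u : i != j -> u \in s j :: p j -> u \notin s i :: p i.
  by rewrite eq_sym => /dp d uj; apply/negP => /(disjointF d uj).
move=> lr; move: pj lj dj (le_size j); case/splitPl: lr => p1 p2 l1.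
rewrite cat_path last_cat l1 => /andP[_ pp2] lp2 dj le dr.
exists (size p1).
  have := le (r ++ p2); rewrite cat_path last_cat pr pp2 !size_cat leq_add2r.
  apply=> // i u ij; rewrite -cat_cons lastI mem_cat mem_rcons inE -orbA.
  case/or3P => [/eqP->|/(dr i)//|u2]; apply: dj => //.
    by rewrite -l1 -cat_cons mem_cat mem_last.
  by rewrite -cat_cons mem_cat u2 orbT.
by rewrite -cat_cons nth_cat /= ltnS leqnn (last_nth (s j)) in l1 *.
Qed.

(** * Linkages in semicomplete digraphs of large out-degree *)

Theorem semicomplete_linkage (T : finType) (E : rel T) k (x y : 'I_k -> T) :
    irreflexive E -> (forall u v, u != v -> E u v || E v u) ->
    injective x -> injective y -> (forall i j, x i != y j) ->
    (forall C : {set T}, #|C| < 3 * k -> connected_avoiding E C) ->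
    (forall v, 22 * k <= #|[set u | E v u] :\: [set y i | i in 'I_k]|) ->
  exists P, linkage E x y P.
Proof.
move=> irr semi xinj yinj xy conn deg.
set Y := [set y i | i in 'I_k] in deg.
pose X := [set x i | i in 'I_k].
have cX : #|X| <= k := card_imset_ord x.
have cY : #|Y| <= k := card_imset_ord y.
have XY : [disjoint X & Y].
  apply/pred0P => u /=; apply/negP => /andP[/imsetP[i _ ->] /imsetP[j _ e]].
  by have := xy i j; rewrite e eqxx.
pose idg v := #|[set u | (u \notin X) && E u v]|.
have [B [sB cB topB]] : exists B : {set T}, [/\ B \subset ~: (X :|: Y), #|B| = 3 * k &
    forall b w, b \in B -> w \in ~: (X :|: Y) :\: B -> idg w <= idg b].
  apply: top_subset; case: (posnP k) => [->//|k0].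
  have := deg (x (Ordinal k0)); have := max_card ([set u | E (x (Ordinal k0)) u] :\: Y).
  have := cardsCs (X :|: Y); have := cardU_le X Y.
  rewrite /=; lia.
have BX b : b \in B -> b \notin X.
  by move=> /(subsetP sB); rewrite !inE negb_or => /andP[].
have BY b : b \in B -> b \notin Y.
  by move=> /(subsetP sB); rewrite !inE negb_or => /andP[].
(* More than [k], because at most [k] vertices of [B] start paths: a vertex of [U] keeps an
   in-neighbour in [B] that starts none. *)
pose U := [set w | k < #|[set b in B | E b w]|].
pose cand i := [set u | E (x i) u] :\: (X :|: Y :|: B :|: U).
pose bad i := k <= #|cand i|.
have [z zinj hz] : exists2 z : 'I_k -> T, injective z & forall i, bad i -> z i \in cand i.
  apply: (@greedy_sdr _ _ (fun i t => bad i -> t \in cand i)) => i F cF.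
  case: (boolP (bad i)) => [bi|nb].
    by have [t tF tc] := subset_card_notin (leq_trans cF bi); exists t.
  (* For an index that is not [bad], [z i] is a filler that keeps [z] injective; [T] has at least
     [k] elements since [x] is injective. *)
  have [t tF _] : exists2 t, t \notin F & t \in [set: T].
    apply: subset_card_notin; apply: leq_trans cF _.
    by rewrite cardsT -[k]card_ord; apply: leq_card xinj.
  by exists t.
pose Z := [set z i | i in [set i | bad i]].
have cZ : #|Z| <= k.
  by apply: leq_trans (leq_imset_card _ _) (leq_trans (max_card _) _); rewrite card_ord.
have ZP u : u \in Z -> [/\ u \notin X, u \notin Y, u \notin B & u \notin U].
  case/imsetP => i; rewrite inE => /hz; rewrite !in_setD !in_setU !negb_or.
  by move=> /andP[/andP[/andP[/andP[? ?] ?] ?] _] ->.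
pose EG u v := [&& E u v, u \notin X :|: Z & v \notin X :|: Z].
have EGE : subrel EG E by move=> u v /and3P[].
have [s [p msys]] : exists s p, minimal_system EG B y s p.
  (* [X], [Z] and a set [C] of fewer than [k] vertices total fewer than [3 * k], so some vertex of
     [B] still reaches a sink while avoiding all three. *)
  apply: ex_minimal_system => // C sepC; rewrite leqNgt; apply/negP => cC.
  have [b bC bB] : exists2 b, b \notin C & b \in B.
    by apply: subset_card_notin; rewrite cB; lia.
  have [c cnC cY'] : exists2 c, c \notin C & c \in Y.
    by apply: subset_card_notin; rewrite card_imset // card_ord.
  have [|||q [pq lq aq]] := conn (X :|: Z :|: C) _ b c.
  - have := cardU_le (X :|: Z) C; have := cardU_le X Z; lia.
  - rewrite !in_setU !negb_or bC (BX b bB) andbT /=.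
    by apply/negP => /ZP[_ _]; rewrite bB.
  - rewrite !in_setU !negb_or cnC andbT (disjointFl XY cY') /=.
    by apply/negP => /ZP[_]; rewrite cY'.
  have : has (mem C) (b :: q).
    apply: sepC; rewrite ?lq //.
    elim: (q) (b) pq aq => //= d q' IH a /andP[ad pq] /and3P[ha hd hq].
    rewrite IH //= ?hd // andbT /EG ad /=.
    by move: ha hd; rewrite !in_setU !negb_or => /andP[-> _] /andP[-> _].
  move=> /hasP[u uq /= uC]; move/allP/(_ u uq): aq.
  by rewrite /= in_setU uC orbT.
have [[hp dp] _] := msys.
pose St := [set s j | j in 'I_k].
have cSt : #|St| <= k := card_imset_ord s.
have StB u : u \in St -> u \in B by case/imsetP => j _ ->; have [] := hp j.
pose VQ := [set u | [exists j, u \in s j :: p j]].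
have VQP u : reflect (exists j, u \in s j :: p j) (u \in VQ).
  by rewrite inE; apply: existsP.
have VQXZ u : u \in VQ -> u \notin X :|: Z.
  case/VQP => j; have [sjB pj _] := hp j; rewrite in_cons => /orP[/eqP->|].
    rewrite in_setU negb_or (BX _ sjB); apply/negP => /ZP[_ _]; by rewrite sjB.
  elim: (p j) (s j) pj => //= d q IH a /andP[/and3P[_ _ hd] pq].
  by rewrite in_cons => /orP[/eqP->//|]; apply: IH pq.
(* On a path too short to have position [a] the default [s j] is read, which only adds a vertex of
   [St]. *)
pose Q a := [set nth (s j) (s j :: p j) a | j in 'I_k].
have cQ a : #|Q a| <= k := card_imset_ord _.
have Q0 : Q 0 = St by [].
have sVQ j : s j \in VQ by apply/VQP; exists j; apply: mem_head.
have YVQ u : u \in Y -> u \in VQ.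
  by case/imsetP => j _ ->; apply/VQP; exists j; have [_ _ <-] := hp j; apply: mem_last.
have BVQ u : u \in B -> u \in VQ -> u \in St.
  move=> uB /VQP[j uj].
  have [//|//|//|a] := @minimal_system_detour _ _ _ _ _ _ _ j u [::] msys uB.
  by rewrite leqn0 => /eqP-> /= ->; apply: imset_f.
have BXZ u : u \in B -> u \notin X :|: Z.
  by move=> uB; rewrite in_setU negb_or BX //; apply/negP => /ZP[_ _]; rewrite uB.
have out1 b v : b \in B :\: St -> E b v -> v \in VQ -> v \in St :|: Q 1.
  rewrite in_setD => /andP[bS bB] bv vQ; have vXZ := VQXZ v vQ.
  case/VQP: vQ => j vj.
  have [|//|i u|a] := @minimal_system_detour _ _ _ _ _ _ _ j b [:: v] msys bB.
  - by rewrite /= /EG bv BXZ // vXZ.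
  - rewrite inE => /eqP->; apply: contra bS => h; apply: BVQ => //.
    by apply/VQP; exists i.
  rewrite -Q0 in_setU /= => le1 ->; case: a le1 => [_|[_|//]].
    by apply/orP; left; apply/imsetP; exists j.
  by apply/orP; right; apply/imsetP; exists j.
have out2 b w v : b \in B :\: St -> E b w -> E w v -> w \notin X :|: Z :|: VQ ->
    v \in VQ -> v \in St :|: Q 1 :|: Q 2.
  rewrite in_setD => /andP[bS bB] bw wv; rewrite in_setU negb_or => /andP[wXZ wQ] vQ.
  have vXZ := VQXZ v vQ; case/VQP: vQ => j vj.
  have [|//|i u|a] := @minimal_system_detour _ _ _ _ _ _ _ j b [:: w; v] msys bB.
  - by rewrite /= /EG bw wv BXZ // wXZ vXZ.
  - rewrite !inE => /orP[]/eqP->.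
      apply: contra bS => h; apply: BVQ => //.
      by apply/VQP; exists i.
    by apply: contra wQ => h; apply/VQP; exists i.
  rewrite -Q0 !in_setU /= => le2 ->.
  case: a le2 => [_|[_|[_|//]]]; apply/orP; [left; apply/orP; left|left; apply/orP; right|right];
    by apply/imsetP; exists j.
(* [B :\: St] has at least [2 * k] vertices. As [z i] is not in [U], at most [k] of them dominate
   it, and by semicompleteness [z i] dominates the others. *)
have [b' b'inj hb'] : exists2 b' : 'I_k -> T, injective b' &
    forall i, b' i \in B :\: St /\ (bad i -> E (z i) (b' i)).
  apply: (@greedy_sdr _ _ (fun i t => t \in B :\: St /\ (bad i -> E (z i) t))) => i F cF.
  have cBS := card_leD B St.
  case: (boolP (bad i)) => [bi|nb]; last first.
    by have [|t] := @subset_card_notin _ (B :\: St) F; [lia|exists t].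
  have [_ _ zB zU] : [/\ z i \notin X, z i \notin Y, z i \notin B & z i \notin U].
    by apply: ZP; apply: imset_f; rewrite inE.
  have [|t] := @subset_card_notin _ ((B :\: St) :\: [set b in B | E b (z i)]) F.
    by move: zU; rewrite inE -leqNgt; have := card_leD (B :\: St) [set b in B | E b (z i)]; lia.
  rewrite in_setD !inE => tF /andP[h /andP[tS tB]]; exists t; rewrite // in_setD tS tB; split=> // _.
  have /semi : t != z i by apply: contraNneq zB => <-.
  by move: h; rewrite tB /= => /negPf->.
pose vv i := if bad i then b' i else x i.
pose N i := [set w | [&& w \notin X :|: Y :|: B :|: Z :|: VQ, E (vv i) w &
                         [exists b in B :\: St, E b w]]].
(* Of the [22 * k] out-neighbours outside [Y], at most [k] are lost to each of [X], [Q 1] and [A],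
   and [3 * k] to [B], where [A] is [Z] if [i] is [bad] and [cand i] otherwise. By [out1] the path
   vertices to exclude lie in [Q 1] or in [St], a part of [B]. *)
have cN i : 16 * k <= #|N i|.
  have dv := deg (vv i).
  suff [A cA sub] : exists2 A : {set T}, #|A| <= k &
      [set u | E (vv i) u] :\: Y \subset N i :|: (X :|: B :|: A :|: Q 1).
    have := subset_leq_card sub; have := cardU_le (N i) (X :|: B :|: A :|: Q 1).
    have := cardU_le (X :|: B :|: A) (Q 1); have := cardU_le (X :|: B) A.
    have := cardU_le X B; have := cQ 1; lia.
  have cut (A : {set T}) : (forall w, E (vv i) w -> w \notin X :|: Y :|: B :|: A ->
        w \notin Z /\ [exists b in B :\: St, E b w]) ->
      [set u | E (vv i) u] :\: Y \subset N i :|: (X :|: B :|: A :|: Q 1).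
    move=> hA; apply/subsetP => w; rewrite in_setD => /andP[wY wE].
    have vw : E (vv i) w by rewrite inE in wE.
    rewrite in_setU orbC; apply/orP.
    have [?|] := boolP (w \in X :|: B :|: A :|: Q 1); [by left|move=> hn; right; move: hn].
    rewrite !in_setU !negb_or => /andP[/andP[/andP[wX wB] wA] wQ1].
    have [|wZ ex] := hA w vw; first by rewrite !in_setU !negb_or wX wY wB wA.
    rewrite inE vw ex !in_setU !negb_or wX wY wB wZ /= andbT.
    case/existsP: ex => b /andP[bB bw]; apply/negP => wQ.
    have := out1 b w bB bw wQ; rewrite in_setU (negPf wQ1) orbF => /StB.
    by rewrite (negPf wB).
  rewrite /vv in dv cut *; case: (boolP (bad i)) dv cut => [bi|nb] dv cut.
    exists Z => //; apply: cut => w bw; rewrite !in_setU !negb_or => /andP[_ wZ].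
    by split=> //; apply/existsP; exists (b' i); have [-> _] := hb' i.
  exists (cand i); first by rewrite ltnW // ltnNge.
  apply: cut => w xw; rewrite in_setU negb_or => /andP[wn wc].
  have wU : w \in U.
    apply: contraR wc => wU; rewrite /cand in_setD [w \in _ :|: U]in_setU negb_or.
    by rewrite wn wU inE.
  split; first by apply/negP => /ZP[_ _ _]; rewrite wU.
  move: wU; rewrite inE => wU.
  have [|b bS] := @subset_card_notin _ [set b in B | E b w] St; first by lia.
  by rewrite inE => /andP[bB bw]; apply/existsP; exists b; rewrite in_setD bS bB.
pose M i w := [set u | [&& u \notin X, E w u & E u (s i)]].
have [w winj hw] : exists2 w : 'I_k -> T, injective w & forall i,
    w i \in N i /\ (E (w i) (s i) \/ 15 * k + 1 < 2 * #|M i (w i)|).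
  apply: (@greedy_sdr _ _ (fun i t => t \in N i /\
    (E t (s i) \/ 15 * k + 1 < 2 * #|M i t|))) => i F cF.
  (* At least [15 * k + 1] candidates remain after removing [F]. They lie outside [X], [Y] and [B],
     so the choice of [B] bounds their in-degrees by that of [s i], as [short_access] requires. *)
  have cP := card_leD (N i) F; have cNi := cN i; have [siB _ _] := hp i.
  have PN t : t \in N i :\: F -> t \notin X :|: Y :|: B.
    by rewrite !inE => /andP[_ /andP[+ _]]; rewrite !negb_or => /andP[/andP[-> _] _].
  have [|||||t tP ht] := @short_access _ E X (N i :\: F) (s i) irr semi.
  - exact: BX.
  - by apply/negP => /PN; rewrite !in_setU siB !orbT.
  - apply/pred0P => t /=; apply/negP => /andP[tX /PN].
    by rewrite !in_setU tX.
  - by lia.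
  - move=> t /PN tn; apply: topB => //; move: tn.
    by rewrite !inE !negb_or => /andP[-> ->].
  exists t; first by move: tP; rewrite in_setD => /andP[].
  split; first by move: tP; rewrite in_setD => /andP[].
  by case: ht => [|h]; [left|right; rewrite /M; lia].
pose W := [set w i | i in 'I_k]; pose B' := [set b' i | i in 'I_k].
have cW : #|W| <= k := card_imset_ord w.
have cB' : #|B'| <= k := card_imset_ord b'.
have WN i : w i \notin X :|: Y :|: B :|: Z :|: VQ.
  by have [h _] := hw i; move: h; rewrite inE => /andP[].
pose far i t := [/\ t \notin X :|: Z :|: VQ :|: W :|: B', E (w i) t & E t (s i)].
have [w' w'inj hw'] : exists2 w' : 'I_k -> T, injective w' &
    forall i, ~~ E (w i) (s i) -> far i (w' i).
  apply: (@greedy_sdr _ _ (fun i t => ~~ E (w i) (s i) -> far i t)) => i F cF.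
  have [wNi [ws|cM]] := hw i.
    have [t tF _] : exists2 t, t \notin F & t \in [set: T].
      apply: subset_card_notin; apply: leq_trans cF _.
      by rewrite cardsT -[k]card_ord; apply: leq_card xinj.
    by exists t; rewrite // ws.
  (* [Bl] and [F] block fewer than [7 * k] vertices, while [M i (w i)] has more than [7 * k]. Of the
     paths only [St], [Q 1] and [Q 2] need blocking: by [out2] the vertex [w i] sends no arc to
     their other vertices. *)
  pose Bl := Z :|: (St :|: Q 1 :|: Q 2) :|: W :|: B'.
  have cBl : #|Bl| <= 6 * k.
    have := cardU_le (Z :|: (St :|: Q 1 :|: Q 2) :|: W) B'.
    have := cardU_le (Z :|: (St :|: Q 1 :|: Q 2)) W.
    have := cardU_le Z (St :|: Q 1 :|: Q 2).
    have := cardU_le (St :|: Q 1) (Q 2); have := cardU_le St (Q 1).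
    have := cQ 1; have := cQ 2; rewrite -/Bl; lia.
  have [|t tF] := @subset_card_notin _ (M i (w i) :\: Bl) F.
    by have := card_leD (M i (w i)) Bl; lia.
  rewrite in_setD => /andP[tBl tM]; exists t => // _.
  have /and3P[tX wt ts] : [&& t \notin X, E (w i) t & E t (s i)] by rewrite inE in tM.
  split=> //.
  move: tBl; rewrite /Bl !in_setU !negb_or.
  move=> /andP[/andP[/andP[-> tQ] ->] ->]; rewrite tX /= !andbT.
  apply/negP => tVQ; move: wNi; rewrite inE => /and3P[wn _ /existsP[b /andP[bB bw]]].
  have /negP : t \notin St :|: Q 1 :|: Q 2 by rewrite !in_setU !negb_or.
  apply; apply: (out2 b (w i)) => //; move: wn.
  by rewrite !in_setU !negb_or => /andP[/andP[/andP[/andP[-> _] _] ->] ->].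
pose L i := (if bad i then [:: z i; b' i] else [::]) ++
  w i :: (if E (w i) (s i) then [::] else [:: w' i]) ++ s i :: p i.
exists L; split=> [i|i j ij].
  have [siB pi li] := hp i; have pE := sub_path EGE pi.
  have Nw : E (vv i) (w i) by have [h _] := hw i; move: h; rewrite inE => /and3P[].
  have tail v : E v (w i) ->
      path E v (w i :: (if E (w i) (s i) then [::] else [:: w' i]) ++ s i :: p i).
    move=> vw; rewrite /= vw /=; case: ifP => [ws|/negbT ws] /=; first by rewrite ws.
    by have [_ -> ->] := hw' i ws.
  split; last by rewrite /L last_cat /= last_cat /= li.
  rewrite /L; move: Nw; rewrite /vv; case: ifP => [bi bw|_ xw]; last exact: tail.
  have [_ /(_ bi) zb] := hb' i.
  have xz : E (x i) (z i) by have := hz i bi; rewrite !inE => /andP[].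
  by rewrite /= xz zb; apply: (tail (b' i)).
(* Colour 2 marks the vertices of the path system, whose paths are disjoint. For any other colour
   [c], a vertex of colour [c] on route [l] is [h c l], and [h c] is injective; entry 2 of the list
   in [h] is a filler. *)
pose col u := if u \in X then 0 else if u \in Z then 1 else if u \in VQ then 2
  else if u \in B' then 3 else if u \in W then 4 else 5.
pose h c i := nth (x i) [:: x i; z i; x i; b' i; w i; w' i] c.
have hinj c : c < 6 -> c != 2 -> injective (h c).
  by case: c => [|[|[|[|[|[|c]]]]]] //= _ _; rewrite /h /=.
have cls l u : u \in x l :: L l ->
    (col u < 6 /\ col u != 2 /\ u = h (col u) l) \/ u \in s l :: p l.
  rewrite /L inE mem_cat inE mem_cat => /orP[/eqP->|].
    by left; rewrite /col imset_f.
  case/orP => [|/or3P[/eqP->||->]]; last by right.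
  - case: ifP => // bl; rewrite !inE => /orP[]/eqP->; left.
      have zZ : z l \in Z by apply: imset_f; rewrite inE.
      by have [zX _ _ _] := ZP _ zZ; rewrite /col (negPf zX) zZ.
    have [+ _] := hb' l; rewrite in_setD => /andP[bS bB].
    have := BXZ _ bB; rewrite in_setU negb_or => /andP[bX bZ].
    have bQ : b' l \notin VQ by apply: contra bS; apply: BVQ.
    by rewrite /col (negPf bX) (negPf bZ) (negPf bQ) imset_f.
  - left; have := WN l; rewrite !in_setU !negb_or.
    move=> /andP[/andP[/andP[/andP[wX _] wB] wZ] wQ].
    have wB' : w l \notin B'.
      apply: contra wB => /imsetP[m _ ->]; have [+ _] := hb' m.
      by rewrite in_setD => /andP[].
    by rewrite /col (negPf wX) (negPf wZ) (negPf wQ) (negPf wB') imset_f.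
  - case: ifP => // /negbT /hw'[wn _ _]; rewrite mem_seq1 => /eqP ->.
    move: wn; rewrite !in_setU !negb_or.
    move=> /andP[/andP[/andP[/andP[wX wZ] wQ] wW] wB'].
    by left; rewrite /col (negPf wX) (negPf wZ) (negPf wQ) (negPf wB') (negPf wW).
have col2 l u : u \in s l :: p l -> col u = 2.
  move=> ul; have uQ : u \in VQ by apply/VQP; exists l.
  have := VQXZ u uQ; rewrite in_setU negb_or => /andP[uX uZ].
  by rewrite /col (negPf uX) (negPf uZ) uQ.
apply: disjointP => u /cls[[c6 [c2 e]]|ui] /cls[[d6 [d2 e']]|uj].
- by move: ij; rewrite (hinj _ c6 c2 i j) ?eqxx // -e.
- by rewrite (col2 _ _ uj) in c2.
- by rewrite (col2 _ _ ui) in d2.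
- exact: disjointF (dp _ _ ij) ui uj.
Qed.

(** * Compositions *)

Lemma path_avoid_rel (T : finType) (E : rel T) (C : {set T}) a p : a \notin C ->
  path (fun u v => [&& E u v, u \notin C & v \notin C]) a p ->
  path E a p /\ all [predC C] (a :: p).
Proof.
move=> aC pp; split; first by apply: sub_path pp => u v /and3P[].
rewrite /= aC /=; elim: p a aC pp => //= b p IHp a aC /andP[/and3P[_ _ bC] pp].
by rewrite bC (IHp b).
Qed.

(* The auxiliary digraph on which the semicomplete theorem is applied: each class
   of c becomes complete, except that Y is entered from its own class only by
   vertices of Y.  Thus a path to y whose other vertices avoid Y cannot stay in
   the class of y. *)
Definition completed (T H : finType) (h : rel H) (c : T -> H) (Y : {set T}) : rel T :=
  fun u v => (u != v) &&
    (h (c u) (c v) || (c u == c v) && ((v \notin Y) || (u \in Y))).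

(** A vertex of [Y] may be unreachable from its own class in one step, so a path of [A] is followed
    only up to classes: each class it meets has a vertex [r] reachable from [a]. The last step
    enters [b] from another class, by [hin]. *)
Lemma completed_connected (T H : finType) (A : rel T) (h : rel H) (c : T -> H)
    (Y C : {set T}) :
    irreflexive h -> (forall u v, c u != c v -> A u v = h (c u) (c v)) ->
    connected_avoiding A C ->
    (forall b, exists2 o, o \notin C & h (c o) (c b)) ->
  connected_avoiding (completed h c Y) C.
Proof.
move=> hirr hA conn hin a b aC bC.
pose e u v := [&& completed h c Y u v, u \notin C & v \notin C].
have hneq u v : h (c u) (c v) -> u != v.
  by move=> huv; apply: contraTneq huv => ->; rewrite hirr.
have rep u : u \notin C -> exists2 r, r \notin C /\ connect e a r & c r = c u.
  have step p d : path A d p -> all [predC C] (d :: p) ->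
      (exists2 r, r \notin C /\ connect e a r & c r = c d) ->
      exists2 r, r \notin C /\ connect e a r & c r = c (last d p).
    elim: p d => [|d' p IHp] d //= /andP[dd' pp] /and3P[dC d'C pC] [r [rC ar] er].
    apply: (IHp d') => //=; first by rewrite d'C.
    have [ed|nd] := eqVneq (c d) (c d'); first by exists r; rewrite // er.
    have hd : h (c r) (c d') by rewrite er -hA.
    exists d' => //; split=> //; apply: connect_trans ar (connect1 _).
    by rewrite /e /completed hd hneq // rC.
  move=> uC; have [p [pp <- ap]] := conn a u aC uC.
  by apply: step pp ap _; exists a.
have [o oC ho] := hin b; have [r [rC ar] er] := rep o oC.
have : connect e a b.
  apply: connect_trans ar (connect1 _); rewrite -er in ho.
  by rewrite /e /completed ho hneq // rC bC.
case/connectP => p pp lp; have [? ?] := path_avoid_rel aC pp.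
by exists p.
Qed.

(* An arc u -> v of the completion inside a class that is not an arc of A is
   bypassed: every vertex following v also follows u. *)
Lemma completed_shortcut (T H : finType) (A : rel T) (h : rel H) (c : T -> H)
    (Y : {set T}) a p :
    irreflexive h -> (forall u v, c u != c v -> A u v = h (c u) (c v)) ->
    path (completed h c Y) a p -> all [predC Y] (belast a p) -> last a p \in Y ->
  exists q, [/\ path A a q, last a q = last a p & {subset q <= p}].
Proof.
move=> hirr hA; have [n] := ubnP (size p); elim: n => // n IHn in a p *.
case: p => [_ _ _ lY|b p]; first by exists [::].
rewrite /= ltnS => sp /andP[ab pp] /andP[aY pY] lY.
have [Aab|nAab] := boolP (A a b).
  have [q [pq lq sq]] := IHn b p sp pp pY lY.
  exists (b :: q); split=> //=; first by rewrite Aab.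
  by move=> v; rewrite !inE => /orP[->//|/sq->]; rewrite orbT.
have ecab : c a = c b.
  apply: contraNeq nAab => ne; rewrite hA //; move: ab.
  by rewrite /completed (negPf ne) /= orbF => /andP[].
have bY : b \notin Y.
  move: ab; rewrite /completed ecab hirr eqxx /= => /andP[_ /orP[//|aY']].
  by rewrite /= aY' in aY.
case: p pp pY lY sp => [|d p] /=; first by rewrite (negPf bY).
move=> /andP[bd pp] /andP[_ pY] lY sp.
have [ead|nad] := eqVneq a d.
  rewrite -ead in pp pY lY *.
  have [q [pq lq sq]] := IHn a p (ltnW sp) pp pY lY.
  by exists q; split=> // v /sq vp; rewrite !inE vp !orbT.
have ad : completed h c Y a d.
  move: bd; rewrite /completed nad ecab => /andP[_ /=].
  by rewrite (negPf bY) orbF => /orP[->//|/andP[-> ->]]; rewrite orbT.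
have [||q [pq lq sq]] := IHn a (d :: p) sp _ _ lY.
- by rewrite /= ad.
- by rewrite /= pY andbT.
exists q; split=> // v /sq; rewrite !inE => /orP[]->; by rewrite !orbT.
Qed.

Lemma large_parts_linkage (T H : finType) (A : rel T) (h : rel H) (c : T -> H)
    k (x y : 'I_k -> T) :
    irreflexive A -> irreflexive h -> (forall s t, s != t -> h s t || h t s) ->
    (forall u v, c u != c v -> A u v = h (c u) (c v)) ->
    injective x -> injective y -> (forall i j, x i != y j) ->
    (forall C : {set T}, #|C| < 3 * k -> connected_avoiding A C) ->
    (forall v, 23 * k <= #|[set u | A v u]|) ->
    (forall v, 3 * k <= #|[set u | c u != c v]|) ->
  exists P, linkage A x y P.
Proof.
move=> Airr hirr hsemi hA xinj yinj xy conn deg big.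
pose Y := [set y i | i in 'I_k]; have cY : #|Y| <= k := card_imset_ord y.
(* Otherwise delete these in-neighbours. By [big] a vertex outside the class of [b] survives, yet
   every path from it enters that class through a deleted vertex. *)
have inn b : 3 * k <= #|[set u | h (c u) (c b)]|.
  rewrite leqNgt; apply/negP => lt.
  have [a aC ab] := subset_card_notin (leq_trans lt (big b)).
  have bC : b \notin [set u | h (c u) (c b)] by rewrite inE hirr.
  have [p [pp lp ap]] := conn _ lt a b aC bC.
  rewrite inE in ab; elim: p a aC ab pp lp ap => [|d p IHp] a _ ab /=.
    by move=> _ e; rewrite e eqxx in ab.
  move=> /andP[ad pp] lp /and3P[aC dC pC].
  have [db|db] := eqVneq (c d) (c b); last by apply: (IHp d) => //=; rewrite dC.
  by move: aC; rewrite inE -db -hA ?ad // db.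
have [||||P lP] :=
  @semicomplete_linkage _ (completed h c Y) k x y _ _ xinj yinj xy.
- by move=> u; rewrite /completed eqxx.
- move=> u v uv; rewrite /completed (eq_sym v) uv /=.
  have [e|ne] := eqVneq (c u) (c v); last by case/orP: (hsemi _ _ ne) => ->; rewrite ?orbT.
  by rewrite e hirr; case: (u \in Y); case: (v \in Y).
- move=> C cC; apply: (@completed_connected _ _ A) => //; first exact: conn.
  move=> d; have [|o oC] := @subset_card_notin _ [set u | h (c u) (c d)] C.
    exact: leq_trans cC (inn d).
  by rewrite inE; exists o.
- move=> v; apply: leq_trans (subset_leq_card (_ : [set u | A v u] :\: Y \subset _)).
    by have := deg v; have := card_leD [set u | A v u] Y; lia.
  apply/subsetP => u; rewrite !in_setD => /andP[uY]; rewrite uY !inE /= => vu.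
  have ne : v != u by apply: contraTneq vu => ->; rewrite Airr.
  rewrite /completed ne uY /= andbT.
  by have [->|ncuv] := eqVneq (c v) (c u); rewrite ?orbT // orbF -hA.
have [Q [hQ dQ] uQ] := linkage_uniq lP.
(* [y i] ends a path without repetitions and every other sink lies on another path, so sinks occur
   only as ends. *)
have QY i : all [predC Y] (belast (x i) (Q i)).
  apply/allP => u uB; apply/negP => /imsetP[j _ eu]; have [pi li] := hQ i.
  have [e|ne] := eqVneq i j.
    have := uQ i; rewrite lastI rcons_uniq li e -eu -e.
    by rewrite uB.
  apply: (disjointF (dQ i j ne) (mem_belast uB)).
  by rewrite eu; have [_ <-] := hQ j; apply: mem_last.
have [R hR] : exists R : 'I_k -> seq T, forall i,
    [/\ path A (x i) (R i), last (x i) (R i) = y i & {subset R i <= Q i}].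
  apply: (@fin_all_exists _ _ (fun i r =>
    [/\ path A (x i) r, last (x i) r = y i & {subset r <= Q i}])) => i.
  have [pi li] := hQ i; rewrite -li; apply: completed_shortcut pi (QY i) _ => //.
  by rewrite li; apply: imset_f.
exists R; split=> [i|i j /dQ d]; first by have [] := hR i.
have sub l : {subset x l :: R l <= x l :: Q l}.
  have [_ _ s] := hR l; move=> v; rewrite !in_cons => /orP[->//|/s->].
  by rewrite orbT.
by apply: disjointP => v /sub vi /sub vj; apply: disjointF d vi vj.
Qed.

(** * Linkages when a set and its complement are completely joined *)

Lemma ex_inj_in (T I : finType) (J : {set I}) (F : {set T}) (d : I -> T) :
  #|J| <= #|F| -> exists2 f : I -> T, {in J &, injective f} & {in J, forall i, f i \in F}.
Proof.
move=> le; pose f i := nth (d i) (enum F) (index i (enum J)).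
have lt i : i \in J -> index i (enum J) < size (enum F).
  by move=> iJ; rewrite -cardE; apply: leq_trans le; rewrite cardE index_mem mem_enum.
exists f => [i j iJ jJ|i iJ]; last by rewrite -mem_enum mem_nth ?lt.
rewrite /f (set_nth_default (d i) _ (lt j jJ)) => /eqP.
rewrite nth_uniq ?enum_uniq ?lt // => /eqP e.
by rewrite -(nth_index i (_ : i \in enum J)) ?e ?nth_index ?mem_enum.
Qed.

(* Pairs inside K use a middle vertex outside K, pairs outside K one inside K.
   The free vertices outside K suffice for all but one of the former, and the
   exceptional pair is joined by a path avoiding everything else. *)
Lemma joined_set_linkage (T : finType) (A : rel T) k (x y : 'I_k -> T) (K : {set T}) :
    1 < k -> injective x -> injective y -> (forall i j, x i != y j) ->
    (forall C : {set T}, #|C| < 3 * k -> connected_avoiding A C) ->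
    2 * k - 3 <= #|~: K| -> 3 * k <= #|K| ->
    (forall u v, u \in K -> v \notin K -> A u v && A v u) ->
  exists P, linkage A x y P.
Proof.
move=> k1 xinj yinj xy conn cK' cK join.
pose X := [set x i | i in 'I_k]; pose Y := [set y i | i in 'I_k].
have cX : #|X| <= k := card_imset_ord x; have cY : #|Y| <= k := card_imset_ord y.
have xX i : x i \in X by apply: imset_f.
have yY i : y i \in Y by apply: imset_f.
pose KK := [set i | (x i \in K) && (y i \in K)].
pose OO := [set i | (x i \notin K) && (y i \notin K)].
pose Fo := ~: K :\: (X :|: Y).
have [g ginj gK] : exists2 g : 'I_k -> T, injective g &
    forall i, g i \in K :\: (X :|: Y).
  apply: (@greedy_sdr _ _ (fun _ t => t \in K :\: (X :|: Y))) => i F cF.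
  apply: subset_card_notin.
  by have := card_leD K (X :|: Y); have := cardU_le X Y; lia.
have cKO : #|KK| + #|OO| <= k.
  have /eqP <- : #|KK :|: OO| == #|KK| + #|OO|.
    rewrite (leq_card_setU KK OO).2; apply/pred0P => i /=; rewrite !inE.
    by case: (x i \in K); rewrite ?andbF.
  by rewrite (leq_trans (max_card _)) // card_ord.
(* At most [k - #|KK|] sources and as many sinks lie outside [K], so [#|Fo|] is at least
   [2 * #|KK| - 3]. This suffices when [#|KK| >= 2], and the claim is trivial otherwise. *)
have cFo : #|KK| <= #|Fo| + 1.
  have outK (f : 'I_k -> T) : (forall i, i \in KK -> f i \in K) ->
      #|~: K :&: [set f i | i in 'I_k]| + #|KK| <= k.
    move=> fK; have sub : ~: K :&: [set f i | i in 'I_k] \subset [set f i | i in ~: KK].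
      apply/subsetP => u; rewrite inE => /andP[+ /imsetP[i _ e]]; rewrite e inE => fi.
      by apply: imset_f; rewrite inE; apply: contra fi; apply: fK.
    have := leq_trans (subset_leq_card sub) (leq_imset_card _ _).
    by have := cardsC KK; rewrite card_ord; lia.
  have := outK x; have := outK y.
  rewrite -/X -/Y => hy hx.
  have {}hx : #|~: K :&: X| + #|KK| <= k by apply: hx => i; rewrite inE => /andP[].
  have {}hy : #|~: K :&: Y| + #|KK| <= k by apply: hy => i; rewrite inE => /andP[].
  have := cardsID (X :|: Y) (~: K); rewrite -/Fo setIUr.
  by have := cardU_le (~: K :&: X) (~: K :&: Y); lia.
have [J [sJ cJ one few]] : exists J : {set 'I_k}, [/\ J \subset KK, #|J| <= #|Fo|,
    (forall i j, i \in KK :\: J -> j \in KK :\: J -> i = j) &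
    (forall i, i \in KK :\: J -> #|Fo| + 1 <= #|KK|)].
  have [le|lt] := leqP #|KK| #|Fo|.
    by exists KK; split=> // i; rewrite ?setDv ?inE.
  have /set0Pn[i iK] : KK != set0 by rewrite -card_gt0; lia.
  exists (KK :\ i); split; first exact: subsetDl.
  - by move: cFo; rewrite (cardsD1 i KK) iK addn1 add1n ltnS.
  - have eqi a : a \in KK :\: (KK :\ i) -> a = i.
      by rewrite in_setD in_setD1 negb_and negbK => /andP[/orP[/eqP//|/negP]].
    by move=> a b /eqi-> /eqi->.
  - by move=> *; lia.
have [f finj fFo] := @ex_inj_in _ _ J Fo x cJ.
pose G := [set g i | i in OO].
(* The other terminals number at most [2 * k - 2]. For the exceptional [i], [#|Fo| < #|KK|], so [Fo]
   and [G] together have fewer than [#|KK| + #|OO| <= k] vertices, and [C i] stays below [3 * k]. *)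
pose C i := Fo :|: ((X :\ x i) :|: (Y :\ y i)) :|: G.
have [q hq] : exists q : 'I_k -> seq T, forall i, i \in KK :\: J ->
    [/\ path A (x i) (q i), last (x i) (q i) = y i & all [predC C i] (x i :: q i)].
  apply: (@fin_all_exists _ _ (fun i r => i \in KK :\: J ->
    [/\ path A (x i) r, last (x i) r = y i & all [predC C i] (x i :: r)])) => i.
  have [iJ|] := boolP (i \in KK :\: J); last by exists [::].
  have iK : [/\ i \in KK, x i \in K & y i \in K].
    by move: (iJ); rewrite !inE => /andP[_ /andP[-> ->]].
  case: iK => iK xK yK.
  have gG u : u \in G -> [/\ u \in K, u \notin X & u \notin Y].
    case/imsetP => j _ ->; have := gK j.
    by rewrite !inE negb_or => /andP[/andP[-> ->] ->].
  have cC : #|C i| < 3 * k.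
    have := few i iJ; have := cardU_le (Fo :|: ((X :\ x i) :|: (Y :\ y i))) G.
    have := cardU_le Fo ((X :\ x i) :|: (Y :\ y i)).
    have := cardU_le (X :\ x i) (Y :\ y i).
    have := cardsD1 (x i) X; have := cardsD1 (y i) Y; rewrite xX yY.
    have : #|G| <= #|OO| by apply: leq_imset_card.
    by rewrite -/(C i); lia.
  have [||r hr] := conn (C i) cC (x i) (y i).
  - rewrite !in_setU !in_setD1 !negb_or eqxx /= -andbA.
    apply/and3P; split; last by apply/negP => /gG[_]; rewrite xX.
      by rewrite !inE xK /= andbF.
    apply/negP => /andP[_ /imsetP[j _ e]]; by have := xy i j; rewrite e eqxx.
  - rewrite !in_setU !in_setD1 !negb_or eqxx andbT -andbA.
    apply/and3P; split; last by apply/negP => /gG[_ _]; rewrite yY.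
      by rewrite !inE yK /= andbF.
    apply/negP => /andP[_ /imsetP[j _ e]]; by have := xy j i; rewrite e eqxx.
  by exists r.
pose P i := if i \in KK :\: J then q i
  else if i \in J then [:: f i; y i] else if i \in OO then [:: g i; y i] else [:: y i].
exists P; split=> [i|i j ij].
  rewrite /P; have [/hq[]//|] := boolP (i \in KK :\: J).
  rewrite in_setD negb_and negbK; have [iJ _|nJ /= nK] := boolP (i \in J).
    split=> //=; have /fFo := iJ; rewrite !inE => /andP[_ fK].
    have := subsetP sJ i iJ; rewrite inE => /andP[xK yK].
    by have /andP[-> _] := join _ _ xK fK; have /andP[_ ->] := join _ _ yK fK.
  have [iO|nO] := boolP (i \in OO); split=> //=.
    move: iO; rewrite inE => /andP[xK yK]; have := gK i; rewrite !inE => /andP[_ gi].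
    by have /andP[_ ->] := join _ _ gi xK; have /andP[-> _] := join _ _ gi yK.
  rewrite andbT; move: nK nO; rewrite !inE.
  have [xK|xK] := boolP (x i \in K); have [yK|yK] := boolP (y i \in K) => //= _ _.
    by have /andP[] := join _ _ xK yK.
  by have /andP[] := join _ _ yK xK.
pose col u := if u \in X then 0 else if u \in Y then 1 else if u \in K then 2 else 3.
pose h c i := nth (x i) [:: x i; y i; g i; f i] c.
(* A regular vertex of route [i] is determined by its colour. The two side conditions are needed
   because [G] contains [g i] only for [i] in [OO], and [f] is injective only on [J]. *)
pose reg i u := [/\ u = h (col u) i, col u = 2 -> i \in OO & col u = 3 -> i \in J].
have YX l : (y l \in X) = false.
  by apply/negP => /imsetP[m _ e]; have := xy m l; rewrite e eqxx.
have regx l : reg l (x l) by rewrite /reg /col xX.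
have regy l : reg l (y l) by rewrite /reg /col YX yY.
have cls l u : u \in x l :: P l -> reg l u \/ l \in KK :\: J /\ u \in x l :: q l.
  rewrite /P; case: ifP => [? ?|_]; first by right.
  rewrite inE => /orP[/eqP->|ui]; left; first exact: regx.
  case: ifP ui => [lJ|_].
    rewrite !inE => /orP[]/eqP->; last exact: regy.
    have := fFo l lJ; rewrite !inE negb_or => /andP[/andP[fX fY] fK].
    by rewrite /reg /col (negPf fX) (negPf fY) (negPf fK).
  case: ifP => [iO|_]; last by rewrite inE => /eqP->; apply: regy.
  rewrite !inE => /orP[]/eqP->; last exact: regy.
  have := gK l; rewrite !inE negb_or => /andP[/andP[gX gY] gi].
  by rewrite /reg /col (negPf gX) (negPf gY) gi.
have regF l m u : l != m -> l \in KK :\: J -> u \in x l :: q l -> reg m u -> False.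
  move=> lm lJ ui [eu h2 h3]; have [_ _ /allP/(_ u ui)] := hq l lJ.
  rewrite /= !in_setU !in_setD1 !negb_or => /andP[/andP[uF /andP[uX uY]] uG].
  move: eu h2 h3 uX uY uF uG; rewrite /col.
  case: ifP => [_ -> _ _|uX]; first by rewrite (inj_eq xinj) eq_sym lm.
  case: ifP => [_ -> _ _ _|uY]; first by rewrite (inj_eq yinj) eq_sym lm.
  case: ifP => [_ -> /(_ erefl) jO _ _ _ _|uK]; first by rewrite /= imset_f.
  by move=> _ _ _ _ _; rewrite !inE uX uY uK.
apply: disjointP => u /cls[ri|[iJ ui]] /cls[rj|[jJ uj]].
- case: ri rj => ei _ i3 [ej _ j3]; move: ij; suff -> : i = j by rewrite eqxx.
  move: ei ej i3 j3; case: (col u) => [|[|[|[|n]]]] /= ->.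
  + by move/xinj.
  + by move/yinj.
  + by move/ginj.
  + by move=> e /(_ erefl) iJ /(_ erefl) jJ; apply: finj.
  + by rewrite /h /= !nth_nil => /xinj.
- by apply: regF jJ uj ri; rewrite eq_sym.
- exact: regF iJ ui rj.
- by rewrite (one i j) ?eqxx in ij.
Qed.

(** * Application to compositions *)

Lemma min_outdeg_le (D : digraph) (v : D) : min_outdeg D <= outdeg v.
Proof.
rewrite /min_outdeg; elim: index_enum (mem_index_enum v) => // u s IHs.
rewrite big_cons inE => /orP[/eqP<-|/IHs le]; first exact: geq_minl.
by apply: leq_trans (geq_minr _ _) le.
Qed.

Lemma kstrong_connected (D : digraph) k (C : {set D}) :
  kstrong k D -> #|C| < k -> connected_avoiding (@darc D) C.
Proof.
case=> _ str /str {}str a b aC bC; have [<-|ne] := eqVneq a b.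
  by exists [::]; rewrite /= aC.
have [p /and3P[pp /eqP lp _]] := str (exist _ a aC) (exist _ b bC) ne.
exists (map val p); split.
- by rewrite -[a]/(val (exist (fun u => u \notin C) a aC)) path_map.
- by rewrite -[a]/(val (exist (fun u => u \notin C) a aC)) last_map lp.
by rewrite /= aC; apply/allP => _ /mapP[u _ ->]; apply: (valP u).
Qed.

Lemma composition_arc (H : digraph) (S : H -> digraph) (a b : composition S) :
  tag a != tag b -> darc a b = darc (tag a) (tag b).
Proof. by rewrite /= /comp_arc => /negPf->. Qed.

Theorem theorem1p4 (k : nat) (hk : 2 <= k)
    (H : digraph) (hH : 2 <= #|H|) (S : H -> digraph)
    (hsemi : semicomplete H)
    (hparts : forall v : H, 2 * k - 3 <= #|[set: composition S] :\: part S v|)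
    (hstrong : kstrong (3 * k) (composition S))
    (hdeg : 23 * k <= min_outdeg (composition S)) :
  klinked k (composition S).
Proof.
have conn (C : {set composition S}) :
  #|C| < 3 * k -> connected_avoiding (@darc (composition S)) C.
  exact: kstrong_connected.
have deg (v : composition S) : 23 * k <= #|[set u | darc v u]|.
  by apply: leq_trans hdeg (min_outdeg_le v).
have card : 3 * k + 1 <= #|composition S| by case: hstrong.
split=> [|x y xinj yinj xy]; first by lia.
suff [P lP] : exists P, linkage (@darc (composition S)) x y P.
  have [Q [hQ dQ] uQ] := linkage_uniq lP; exists Q; split=> // i.
  by have [pi li] := hQ i; rewrite /dipath pi li eqxx uQ.
pose c (u : composition S) : H := tag u.
have arcE (u v : composition S) : c u != c v -> darc u v = darc (c u) (c v).
  exact: composition_arc.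
have [big|/not_all_ex_not[v0 /negP]] :=
    classic (forall v : composition S, 3 * k <= #|[set u | c u != c v]|).
  by apply: (large_parts_linkage (@darc_irr _) (@darc_irr H) hsemi arcE).
rewrite -ltnNge => small; pose K := [set u | c u == c v0].
have K'E : ~: K = [set u | c u != c v0] by apply/setP => u; rewrite !inE.
have cK : #|K| + #|~: K| = #|composition S| := cardsC K.
(* Fewer than [3 * k] of the at least [23 * k] out-neighbours of [o] lie outside [K]. So one lies in
   [K], and in a composition [o] then dominates all of [K]. *)
have into o u : o \notin K -> u \in K -> darc o u.
  rewrite !inE => oK /eqP uK; rewrite arcE ?uK //.
  have [|w wK] := @subset_card_notin _ [set w | darc o w] (~: K).
    by rewrite K'E; apply: leq_trans small _; have := deg o; lia.
  rewrite inE => ow; move: wK; rewrite !inE negbK => /eqP wK.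
  by rewrite -wK -arcE // wK.
have outof o u : o \notin K -> u \in K -> darc u o.
  move=> oK uK; move: (oK) (uK); rewrite !inE => oK' /eqP uK'.
  rewrite arcE ?uK' 1?eq_sym //; apply/negPn/negP => no.
  (* The out-neighbours of [K] outside [K] are fewer than [3 * k]; were [o] not among them, deleting
     them would leave no path from [u] to [o]. *)
  pose C := [set w | (w \notin K) && darc (c v0) (c w)].
  have cC : #|C| < 3 * k.
    apply: leq_ltn_trans small; rewrite -K'E; apply: subset_leq_card.
    by apply/subsetP => w; rewrite !inE => /andP[].
  have uC : u \notin C by rewrite !inE uK' eqxx.
  have oC : o \notin C by rewrite !inE oK' (negPf no).
  have [p [pp lp ap]] := conn C cC u o uC oC.
  elim: p u uK {uK' no uC} pp lp ap => [|d p IHp] u uK /=.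
    by move=> _ e; rewrite e (negPf oK) in uK.
  move=> /andP[ud pp] lp /and3P[uC dC pC].
  have [dK|dK] := boolP (d \in K); first by apply: (IHp d) => //=; rewrite dC.
  case/negP: dC; move: (dK) (uK); rewrite !inE => dK' /eqP uK'.
  by rewrite dK' -uK' -arcE // uK' eq_sym.
apply: (joined_set_linkage hk xinj yinj xy conn (K := K)).
- apply: leq_trans (hparts (c v0)) (eq_leq _); apply: eq_card => u.
  by rewrite !inE andbT.
- by have := deg v0; have := max_card [set u | darc v0 u]; rewrite K'E in cK; lia.
- by move=> u v uK vK; apply/andP; split; [apply: outof|apply: into].
Qed.
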